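(* For every finite set $A\subset\mathbb{R}$, $$|A(A+A+A+A)|\gg \frac{|A|^2}{\log|A|},$$ where $A(A+A+A+A)=\{a(b+c+d+e): a,b,c,d,e\in A\}$.
   Context: $X\gg Y$ means $X\geq cY$ for some absolute constant $c>0$. Logarithms are to base 2. *)

(* Defs.v *)
From HB Require Import structures.
From mathcomp Require Import all_boot all_order all_algebra finmap.
From mathcomp Require Import all_classical all_reals exp.
From mathcomp Require Import Rstruct.
From Stdlib Require Import Reals.
Set Implicit Arguments. Unset Strict Implicit. Unset Printing Implicit Defensive.
Import Order.TTheory GRing.Theory Num.Theory.
Local Open Scope ring_scope.
Local Open Scope fset_scope.

Definition log2 (x : R) : R := ln x / ln 2.

Definition sumset (A B : {fset R}) : {fset R} := [fset (a + b)%R | a in A, b in B].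

Definition prod_sum4 (A : {fset R}) : {fset R} :=
  [fset (a * s)%R | a in A, s in sumset (sumset (sumset A A) A) A].

(* Main.v *)
(* Passing to the positive elements of [A], or to the opposites of its negative
   ones, we may assume that [A] is positive. Put [S = A + A], [n = |S|], and for
   a slope [m] let [r(m)] count the points of [A * A] on the line [y = m x], and
   [E(m)] the pairs of points of [S * S] on a common line of slope [m]. By Cauchy-Schwarz,
   [|A|^2 n^4 <= |A(S + S)| T], where [T], the number of solutions of
   [a(s1 + s2) = a'(s3 + s4)], is at most [\sum_m r(m) E(m)].
   Let [D_t] be the set of slopes with [r(m) >= t]. Solymosi's argument gives
   [|D_t| t^2 <= 2 n^2]. Cutting [S * S] into a grid of cells of side about
   [n / t] yields the Szemeredi-Trotter type bound
   [\sum_(m in D_t) E(m) <= 18 n^4 / t], because a line of positive slope visits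
   few cells and two distinct points determine at most one slope. Summing over
   [t <= |A|] bounds [T] by [18 n^4] times a harmonic sum. *)
Require Import Defs.
From HB Require Import structures.
From mathcomp Require Import all_boot all_order all_algebra finmap.
From mathcomp Require Import all_classical all_reals exp.
From mathcomp Require Import Rstruct.
From mathcomp Require Import zify lra ring.
Import Order.TTheory GRing.Theory Num.Theory.
Set Implicit Arguments. Unset Strict Implicit. Unset Printing Implicit Defensive.
Local Open Scope nat_scope.

(** * Counting coincidences: forms of the Cauchy-Schwarz inequality *)

Lemma sum_pred1 (T : eqType) (X : seq T) (x : T) :
  uniq X -> \sum_(v <- X) (x == v) = (x \in X).
Proof.
move=> uX; rewrite -(count_uniq_mem x uX) -sum1_count [RHS]big_mkcond /=.
by apply: eq_bigr => v _; rewrite eq_sym; case: eqP.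
Qed.

Lemma sum_pred1M (T : eqType) (X : seq T) (x y : T) :
  uniq X -> x \in X -> \sum_(v <- X) (x == v) * (y == v) = (x == y).
Proof.
move=> uX xX; transitivity (\sum_(v <- X) (x == v) * (x == y)).
  by apply: eq_bigr => v _; case: (x =P v) => // <-; rewrite eq_sym.
by rewrite -big_distrl /= sum_pred1 // xX mul1n.
Qed.

(** If a value [v] has [k] preimages under [f] and [l] under [g], it contributes
    [2 k l <= k^2 + l^2]; sum over all values. *)
Lemma sum_coincidences_le (I J T : eqType) (P : seq I) (Q : seq J)
    (f : I -> T) (g : J -> T) :
  2 * (\sum_(p <- P) \sum_(q <- Q) (f p == g q)) <=
  \sum_(p <- P) \sum_(q <- P) (f p == f q) +
  \sum_(p <- Q) \sum_(q <- Q) (g p == g q).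
Proof.
pose V := undup (map f P ++ map g Q).
have split (I1 I2 : eqType) (P1 : seq I1) (P2 : seq I2) (h : I1 -> T)
    (k : I2 -> T) : {subset map h P1 <= V} ->
  \sum_(p <- P1) \sum_(q <- P2) (h p == k q) =
  \sum_(v <- V) (\sum_(p <- P1) (h p == v)) * (\sum_(q <- P2) (k q == v)).
  move=> hV; under [RHS]eq_bigr do rewrite big_distrlr /=.
  rewrite [RHS]exchange_big /=; apply: eq_big_seq => p pP.
  rewrite [RHS]exchange_big /=; apply: eq_bigr => q _.
  by rewrite sum_pred1M ?undup_uniq //; apply/hV/map_f.
have fV : {subset map f P <= V} by move=> x; rewrite mem_undup mem_cat => ->.
have gV : {subset map g Q <= V}.
  by move=> x; rewrite mem_undup mem_cat orbC => ->.
rewrite !split // big_distrr -big_split /=.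
by apply: leq_sum => v _; rewrite !mulnn nat_Cauchy.
Qed.

(** Let [C x y] count the coincidences of [f] between the fibres of [g] over [x] and [y]. Summing
    [2 C x y <= C x x + C y y] over [X * X] leaves only the diagonal terms, each taken [size X]
    times. *)
Lemma Cauchy_Schwarz_fibers (I T1 T2 : eqType) (P : seq I) (f : I -> T1)
    (g : I -> T2) (X : seq T2) :
  uniq X -> {in P, forall p, g p \in X} ->
  \sum_(p <- P) \sum_(q <- P) (f p == f q) <=
  size X * \sum_(p <- P) \sum_(q <- P) ((f p == f q) && (g p == g q)).
Proof.
move=> uX gX.
pose C x y := \sum_(p <- P | g p == x) \sum_(q <- P | g q == y) (f p == f q).
have CE x y : C x y =
    \sum_(p <- P) \sum_(q <- P) (g p == x) * (g q == y) * (f p == f q).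
  rewrite /C big_mkcond /=; apply: eq_bigr => p _.
  case: (g p == x); last by rewrite big1.
  rewrite big_mkcond /=; apply: eq_bigr => q _.
  by case: (g q == y); rewrite ?mul1n.
have CAM x y : 2 * C x y <= C x x + C y y.
  have CF u v : C u v = \sum_(p <- [seq p <- P | g p == u])
      \sum_(q <- [seq q <- P | g q == v]) (f p == f q).
    by rewrite big_filter; apply: eq_bigr => p _; rewrite big_filter.
  by rewrite !CF; apply: sum_coincidences_le.
have -> : \sum_(p <- P) \sum_(q <- P) (f p == f q) =
    \sum_(x <- X) \sum_(y <- X) C x y.
  under [RHS]eq_bigr do under eq_bigr do rewrite CE.
  under [RHS]eq_bigr do rewrite exchange_big /=.
  rewrite [RHS]exchange_big /=; apply: eq_big_seq => p pP.
  under [RHS]eq_bigr do rewrite exchange_big /=.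
  rewrite [RHS]exchange_big /=; apply: eq_big_seq => q qP.
  under [RHS]eq_bigr do
    (rewrite -big_distrl /= -big_distrr /= sum_pred1 // gX // muln1).
  by rewrite -big_distrl /= sum_pred1 // gX // mul1n.
have -> : \sum_(p <- P) \sum_(q <- P) ((f p == f q) && (g p == g q)) =
    \sum_(x <- X) C x x.
  under [RHS]eq_bigr do rewrite CE.
  rewrite [RHS]exchange_big /=; apply: eq_big_seq => p pP.
  rewrite [RHS]exchange_big /=; apply: eq_big_seq => q qP.
  by rewrite -big_distrl /= sum_pred1M ?gX // mulnb andbC.
rewrite -(leq_pmul2l (isT : 0 < 2)) big_distrr /=.
under eq_bigr do rewrite big_distrr /=.
apply: (leq_trans (n := \sum_(x <- X) \sum_(y <- X) (C x x + C y y))).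
  by apply: leq_sum => x _; apply: leq_sum => y _.
under eq_bigr do rewrite big_split /= big_const_seq count_predT iter_addn_0.
rewrite big_split /= -big_distrl /= big_const_seq count_predT iter_addn_0.
lia.
Qed.

(** * Ranks and blocks of consecutive elements *)

(** Dividing this position by [b] cuts [S] into blocks by population rather than by length, and
    remains monotone. *)
Definition rank (F : realFieldType) (S : seq F) (x : F) : nat :=
  count (fun z => (z < x)%R) S.

Lemma rank_le (F : realFieldType) (S : seq F) (x y : F) :
  (x <= y)%R -> rank S x <= rank S y.
Proof. by move=> xy; apply: sub_count => z /= /lt_le_trans; apply. Qed.

Lemma rank_lt (F : realFieldType) (S : seq F) (x y : F) :
  x \in S -> (x < y)%R -> rank S x < rank S y.
Proof.
move=> xS xy; rewrite /rank !(permP (perm_to_rem xS)) /= ltxx xy ltnS.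
exact/rank_le/ltW.
Qed.

Lemma rank_lt_size (F : realFieldType) (S : seq F) (x : F) :
  x \in S -> rank S x < size S.
Proof.
move=> xS; rewrite /rank (permP (perm_to_rem xS)) /= ltxx add0n.
by rewrite (perm_size (perm_to_rem xS)) ltnS count_size.
Qed.

Lemma rank_inj (F : realFieldType) (S : seq F) : {in S &, injective (rank S)}.
Proof.
move=> x y xS yS xy.
by case: (ltgtP x y) => // /rank_lt; [move/(_ _ xS)|move/(_ _ yS)];
  rewrite xy ltnn.
Qed.

(** Ranks are injective on [S], and those with quotient [j] lie among the [b] integers from [j * b]
    on. *)
Lemma rank_block_le (F : realFieldType) (S : seq F) (b j : nat) :
  uniq S -> 0 < b -> \sum_(y <- S) (j == rank S y %/ b) <= b.
Proof.
move=> uS b0.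
have -> : \sum_(y <- S) (j == rank S y %/ b) =
    size [seq rank S y | y <- [seq y <- S | j == rank S y %/ b]].
  rewrite size_map size_filter -sum1_count [RHS]big_mkcond /=.
  by apply: eq_bigr => y _; case: eqP.
rewrite -[leqRHS](size_iota (j * b)); apply: uniq_leq_size.
  rewrite map_inj_in_uniq ?filter_uniq // => x y; rewrite !mem_filter.
  by move=> /andP[_ xS] /andP[_ yS]; apply: rank_inj.
move=> r /mapP[y]; rewrite mem_filter => /andP[/eqP -> _ ->].
by rewrite mem_iota leq_divM addnC -mulSn ltn_ceil.
Qed.

(** * Energy of parallel lines, bounded through a grid of cells *)

(** This is [E(m)]: the intercept labels the line of slope [m] through a point. *)
Definition line_energy (F : realFieldType) (S : seq F) (m : F) : nat :=
  \sum_(p <- [seq (x, y) | x <- S, y <- S])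
    \sum_(q <- [seq (x, y) | x <- S, y <- S])
      (p.2 - m * p.1 == q.2 - m * q.1)%R.

(* A line of positive slope meets the [k * k] grid of rank blocks in a chain,
   on which the sum of the two block indices is injective; hence it visits at
   most [2 * k - 1] cells. *)
Lemma line_cell_inj (F : realFieldType) (S : seq F) (b : nat) (m : F)
    (p q : F * F) : (0 < m)%R ->
  (p.2 - m * p.1 = q.2 - m * q.1)%R ->
  rank S p.1 %/ b + rank S p.2 %/ b = rank S q.1 %/ b + rank S q.2 %/ b ->
  rank S p.1 %/ b = rank S q.1 %/ b /\ rank S p.2 %/ b = rank S q.2 %/ b.
Proof.
move=> m0; wlog le_pq : p q / (p.1 <= q.1)%R => [hw e1 e2|e1 e2].
  case: (leP p.1 q.1) => [/hw|/ltW /hw]; first exact.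
  by case/(_ (esym e1) (esym e2)) => -> ->.
have le2 : (p.2 <= q.2)%R.
  rewrite -subr_ge0; suff -> : (q.2 - p.2 = m * (q.1 - p.1))%R.
    by rewrite mulr_ge0 ?subr_ge0 // ltW.
  by rewrite mulrBr; lra.
have := leq_div2r b (rank_le S le_pq); have := leq_div2r b (rank_le S le2).
move: e2; lia.
Qed.

(** For each slope, Cauchy-Schwarz over the cells met by a line leaves only pairs inside one cell;
    these are then counted over all slopes at once. *)
Lemma sum_line_energy_le (F : realFieldType) (S D : seq F) (b : nat) :
  uniq S -> uniq D -> {in D, forall m, (0 < m)%R} -> 0 < b ->
  \sum_(m <- D) line_energy S m <=
  (2 * ((size S).-1 %/ b)).+1 * (size D * size S ^ 2 + (size S * b) ^ 2).
Proof.
move=> uS uD D0 b0; pose K := (2 * ((size S).-1 %/ b)).+1.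
pose P := [seq (x, y) | x <- S, y <- S].
have uP : uniq P by apply: allpairs_uniq => // -[? ?] [? ?] _ _.
have sP : size P = size S ^ 2 by rewrite size_allpairs mulnn.
pose c x := rank S x %/ b.
have cell m : (0 < m)%R -> line_energy S m <= K * \sum_(p <- P) \sum_(q <- P)
    ((p.2 - m * p.1 == q.2 - m * q.1)%R &&
     ((c p.1 == c q.1) && (c p.2 == c q.2))).
  move=> m0.
  (* Both block indices are at most [(size S).-1 %/ b], so their sum takes at most [K] values. *)
  have cK p : p \in P -> c p.1 + c p.2 \in iota 0 K.
    case/allpairsP => -[x y] [xS yS ->]; rewrite mem_iota add0n /K ltnS mul2n.
    have rS z : z \in S -> c z <= (size S).-1 %/ b.
      by move=> /rank_lt_size h; rewrite leq_div2r // -ltnS (ltn_predK h).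
    by rewrite -addnn leq_add //= rS.
  apply: (leq_trans (Cauchy_Schwarz_fibers _ (iota_uniq 0 K) cK)).
  rewrite size_iota leq_mul2l; apply/orP; right.
  apply: leq_sum => p _; apply: leq_sum => q _.
  case: eqP => //= e1; case: eqP => //= e2.
  by have [h1 h2] := line_cell_inj m0 e1 e2; rewrite /c h1 h2 !eqxx.
apply: (leq_trans (n := \sum_(m <- D) K * \sum_(p <- P) \sum_(q <- P)
    ((p.2 - m * p.1 == q.2 - m * q.1)%R &&
     ((c p.1 == c q.1) && (c p.2 == c q.2))))).
  by rewrite !big_seq; apply: leq_sum => m /D0 /cell.
rewrite -big_distrr leq_pmul2l //=.
rewrite exchange_big /=; under eq_bigr do rewrite exchange_big /=.
(* A diagonal pair counts for every slope, any other pair for at most one: none if the abscissas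
   agree, otherwise only the slope of the line through the two points. *)
apply: (leq_trans (n := \sum_(p <- P) \sum_(q <- P)
   (size D * (p == q) + (c p.1 == c q.1) * (c p.2 == c q.2)))).
  apply: leq_sum => p _; apply: leq_sum => q _; rewrite mulnb.
  case: andP => [_|_]; last by rewrite big1 // => m _; rewrite andbF.
  under eq_bigr do rewrite andbT.
  have [<-|pq] := eqVneq p q.
    under eq_bigr do rewrite eqxx.
    by rewrite big_const_seq count_predT iter_addn; lia.
  rewrite muln0 add0n.
  have [e1|n1] := eqVneq p.1 q.1.
    rewrite big1 // => m _; rewrite e1; case: eqP => // e2.
    case/eqP: pq.
    case: p q e1 e2 => [x y] [x' y'] /= -> /(congr1 (+%R^~ (m * x')%R)).
    by rewrite !subrK => ->.
  apply: (leq_trans (n := \sum_(m <- D) ((q.2 - p.2) / (q.1 - p.1) == m)%R)).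
    apply: leq_sum => m _; case: eqP => // e; case: eqP => // -[].
    have q1 : (q.1 - p.1 != 0)%R by rewrite subr_eq0 eq_sym.
    have -> : (q.2 - p.2 = m * (q.1 - p.1))%R by rewrite mulrBr; lra.
    by rewrite mulfK.
  by rewrite sum_pred1 // leq_b1.
under eq_bigr do rewrite big_split -big_distrr /=.
rewrite big_split -big_distrr /= leq_add //.
  rewrite leq_mul2l; apply/orP; right; rewrite -sP -sum1_size.
  by rewrite leq_sum // => p _; rewrite sum_pred1 // leq_b1.
(* Sharing a cell is a condition on each coordinate separately, so the count is a square. *)
have -> : \sum_(p <- P) \sum_(q <- P) (c p.1 == c q.1) * (c p.2 == c q.2) =
    (\sum_(x <- S) \sum_(y <- S) (c x == c y)) ^ 2.
  rewrite -mulnn big_allpairs big_distrlr /=; apply: eq_bigr => x _.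
  by apply: eq_bigr => x' _; rewrite big_allpairs big_distrlr.
rewrite leq_sqr; apply: (leq_trans (n := \sum_(x <- S) b)).
  by apply: leq_sum => x _; apply: rank_block_le.
by rewrite big_const_seq count_predT iter_addn_0 mulnC.
Qed.

(** * Rich slopes through the origin *)

(** This is [r(m)], counting points of [A * A] on the line by their abscissas. *)
Definition richness (F : realFieldType) (A : seq F) (m : F) : nat :=
  count (fun a => (m * a)%R \in A) A.

Section Sums.
Variables (F : realFieldType) (A S : seq F).
Hypotheses (uniqA : uniq A) (uniqS : uniq S).
Hypothesis A_gt0 : {in A, forall a, (0 < a)%R}.
Hypothesis addAS : {in A &, forall a b, (a + b)%R \in S}.
Hypothesis S_gt0 : {in S, forall s, (0 < s)%R}.

Let SS := [seq (x, y) | x <- S, y <- S].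

Lemma size_le_sums : size A <= size S.
Proof.
case E : A => [//|a0 A']; rewrite -E.
rewrite -(size_map (fun a => a + a0)%R); apply: uniq_leq_size.
  by rewrite map_inj_uniq // => x y /addIr.
by move=> _ /mapP[a aA ->]; apply: addAS => //; rewrite E mem_head.
Qed.

Lemma richness_le_size (m : F) : richness A m <= size A.
Proof. exact: count_size. Qed.

(** Add a point on the line of slope [m] to one on the line of slope [m']: the two directions are
    independent, so the sums are distinct, and positivity puts them strictly between the lines. *)
Lemma sector_ge (m m' : F) : (m < m')%R ->
  richness A m * richness A m' <=
  count (fun p => (m * p.1 < p.2)%R && (p.2 < m' * p.1)%R) SS.
Proof.
move=> mm'; rewrite /richness -!size_filter.
set B := [seq a <- A | (m * a)%R \in A]; set C := [seq a <- A | (m' * a)%R \in A].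
pose h (p : F * F) := ((p.1 + p.2)%R, (m * p.1 + m' * p.2)%R).
rewrite -(size_allpairs pair B C) -(size_map h); apply: uniq_leq_size.
  rewrite map_inj_uniq.
    by apply: allpairs_uniq; rewrite ?filter_uniq // => -[? ?] [? ?] _ _.
  move=> [a a'] [b b'] [/= e1 e2].
  have e : ((m' - m) * (a' - b') = 0)%R.
    have -> : ((m' - m) * (a' - b') =
      (m * a + m' * a') - (m * b + m' * b') - m * ((a + a') - (b + b')))%R by ring.
    by rewrite e1 e2 !subrr mulr0 subrr.
  move/eqP: e; rewrite mulf_eq0 !subr_eq0 (gt_eqF mm') /= => /eqP ea.
  by move: e1; rewrite ea => /addIr ->.
move=> _ /mapP[_ /allpairsP[[a a'] /= [aB aC ->]] ->]; rewrite /h /=.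
move: aB aC; rewrite !mem_filter /= => /andP[maA aA] /andP[maA' aA'].
have a0 := A_gt0 aA; have a'0 := A_gt0 aA'.
rewrite allpairs_f ?addAS // andbT !mulrDr ltrD2l ltrD2r.
by rewrite !ltr_pM2r // mm'.
Qed.

(* Solymosi's argument: sums of points on consecutive rich lines through the
   origin are distinct and lie in the open sectors between these lines. *)
Lemma rich_path_le (t : nat) (m : F) (s : seq F) :
  path <%R%R m s -> all (fun m => t <= richness A m) (m :: s) ->
  t ^ 2 * size s <= count (fun p => (m * p.1 < p.2)%R) SS.
Proof.
elim: s m => [|m' s IHs] m /=; first by rewrite muln0.
move=> /andP[mm' ps] /and3P[tm tm' ts].
have {}IHs := IHs m' ps; rewrite /= tm' ts in IHs.
rewrite mulnS -mulnn.
apply: (leq_trans (leq_add (leq_mul tm tm') (IHs isT))).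
apply: (leq_trans (leq_add (sector_ge mm') (leqnn _))).
rewrite -count_predUI [X in _ + X](_ : _ = 0).
  rewrite addn0; set a := predU _ _.
  rewrite -!size_filter; apply: uniq_leq_size.
    by apply/filter_uniq/allpairs_uniq => // -[? ?] [? ?] _ _.
  move=> p; rewrite !mem_filter => /andP[ap pSS]; rewrite pSS andbT.
  case/orP: ap => [/andP[]//|/=]; apply: le_lt_trans.
  case/allpairsP: pSS => -[x y] [/S_gt0 x0 _ ->] /=.
  by rewrite ler_pM2r ?ltW.
apply/eqP; rewrite -leqn0 leqNgt -has_count; apply/hasPn => p _ /=.
by apply/negP => /andP[/andP[_ h1] h2]; move: (lt_trans h1 h2); rewrite ltxx.
Qed.

(** Sorting [D] gives one sector fewer than there are slopes; the missing [t ^ 2] is paid by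
    [t <= size A <= size S], whence the factor 2. *)
Lemma rich_slopes_le (t : nat) (D : seq F) :
  uniq D -> {in D, forall m, t <= richness A m} ->
  size D * t ^ 2 <= 2 * size S ^ 2.
Proof.
move=> uD tD.
have := sort_lt_sorted D; rewrite uD -(size_sort <=%R%R D).
have : {in sort <=%R%R D, forall m, t <= richness A m}.
  by move=> m; rewrite mem_sort; apply: tD.
case: (sort _ D) => [//|m s] /allP ts ps /=.
have := rich_path_le ps ts.
have := count_size (fun p => (m * p.1 < p.2)%R) SS.
rewrite size_allpairs mulSn [_ * t ^ 2]mulnC.
have : t ^ 2 <= size S ^ 2.
  rewrite leq_sqr (leq_trans _ size_le_sums) //.
  by case/andP: ts => /leq_trans h _; apply: h; apply: richness_le_size.
lia.
Qed.

Lemma sum_rich_line_energy_le (t : nat) (D : seq F) :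
  uniq D -> {in D, forall m, (0 < m)%R} -> 0 < t <= size S ->
  {in D, forall m, t <= richness A m} ->
  t * \sum_(m <- D) line_energy S m <= 18 * size S ^ 4.
Proof.
move=> uD D0 /andP[t0 tS] tD.
set e := \sum_(m <- D) _; set n := size S in tS *.
(* This choice gives [n <= t * b <= 2 * n], so [size D * t ^ 2] and [(t * b) ^ 2] are both of order
   [n ^ 2]. The constant is [18 = 3 * (2 + 4)], the 3 coming from the bound on [(2 * q).+1 * b]. *)
pose b := (n %/ t).+1.
have le_e := sum_line_energy_le uniqS uD D0 (ltn0Sn _ : 0 < b).
rewrite -/e -/n in le_e.
have dt := rich_slopes_le uD tD; rewrite -/n in dt.
have n_tb : n <= t * b by rewrite mulnC ltnW // ltn_ceil.
have tb_n : t * b <= 2 * n.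
  by rewrite mulnS mulnC; have := leq_divM n t; lia.
have b_n : b <= n.+1 by rewrite ltnS leq_div.
set q := (n.-1 %/ b) in le_e.
have qb : (2 * q).+1 * b <= 3 * n by have := leq_divM n.-1 b; rewrite -/q; nia.
have n0 : 0 < n by apply: leq_trans tS.
rewrite -(leq_pmul2r n0).
apply: (leq_trans (leq_mul (leqnn _) n_tb)).
apply: (leq_trans (n := t ^ 2 * ((2 * q).+1 * b) * (n ^ 2 * (size D + b ^ 2)))).
  have -> : t * e * (t * b) = t ^ 2 * b * e by ring.
  have -> : t ^ 2 * ((2 * q).+1 * b) * (n ^ 2 * (size D + b ^ 2)) =
    t ^ 2 * b * ((2 * q).+1 * (size D * n ^ 2 + (n * b) ^ 2)) by ring.
  by rewrite leq_mul2l le_e orbT.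
apply: (leq_trans (n := t ^ 2 * (3 * n) * (n ^ 2 * (size D + b ^ 2)))).
  by rewrite leq_mul2r leq_mul2l qb !orbT.
have -> : t ^ 2 * (3 * n) * (n ^ 2 * (size D + b ^ 2)) =
  3 * n ^ 3 * (size D * t ^ 2 + (t * b) ^ 2) by ring.
have -> : 18 * n ^ 4 * n = 3 * n ^ 3 * (2 * n ^ 2 + (2 * n) ^ 2) by ring.
by rewrite leq_mul2l leq_add ?leq_sqr ?orbT.
Qed.

(** * From products to line energies, and summation over richness levels *)

(** With [m = a' / a], the equation reads [u.1 - m * v.1 = - (u.2 - m * v.2)]: the points
    [(v.1, u.1)] and [(v.2, u.2)] have opposite intercepts. Coincidences between [phi] and [- phi]
    are at most those of [phi] with itself. *)
Lemma sum_dilate_le (a a' : F) : (0 < a)%R ->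
  \sum_(u <- SS) \sum_(v <- SS) (a * (u.1 + u.2) == a' * (v.1 + v.2))%R <=
  line_energy S (a' / a).
Proof.
move=> a0; set m := (a' / a)%R.
have mE x y : (a * x == a' * y)%R = (x == m * y)%R.
  rewrite -[RHS](inj_eq (mulfI (lt0r_neq0 a0))) mulrA.
  by rewrite [(a * m)%R]mulrC /m divfK ?lt0r_neq0.
pose phi (p : F * F) := (p.2 - m * p.1)%R.
have -> : \sum_(u <- SS) \sum_(v <- SS)
      (a * (u.1 + u.2) == a' * (v.1 + v.2))%R =
    \sum_(p <- SS) \sum_(q <- SS) (phi p == - phi q)%R.
  rewrite !big_allpairs [RHS]exchange_big /=; apply: eq_bigr => x1 _.
  under eq_bigr do rewrite big_allpairs.
  rewrite exchange_big /=; apply: eq_bigr => y1 _.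
  rewrite big_allpairs exchange_big /=; apply: eq_bigr => y2 _.
  apply: eq_bigr => x2 _; rewrite mE /phi /=; congr (nat_of_bool _).
  by apply/eqP/eqP; rewrite mulrDr; lra.
rewrite -(leq_pmul2l (isT : 0 < 2)).
apply: (leq_trans (sum_coincidences_le _ _ _ _)).
rewrite mul2n -addnn leq_add //.
by under eq_bigr do under eq_bigr do rewrite eqr_opp.
Qed.

Variable X : seq F.
Hypothesis uniqX : uniq X.
Hypothesis mulX : forall a s s', a \in A -> s \in S -> s' \in S ->
  (a * (s + s'))%R \in X.

Lemma sqr_size_le_line_energies :
  (size A * size S ^ 2) ^ 2 <=
  size X * \sum_(a <- A) \sum_(a' <- A) line_energy S (a' / a).
Proof.
pose P := [seq (a, u) | a <- A, u <- SS].
pose g (p : F * (F * F)) := (p.1 * (p.2.1 + p.2.2))%R.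
have gX : {in P, forall p, g p \in X}.
  move=> _ /allpairsP[[a u] /= [aA /allpairsP[[s s'] /= [sS s'S ->]] ->]].
  exact: mulX.
(* With a constant first map every pair coincides, so the left side is the square of [size P]. *)
have := Cauchy_Schwarz_fibers (fun=> tt) uniqX gX.
under eq_bigr do under eq_bigr do rewrite eqxx.
rewrite big_const_seq count_predT iter_addn_0 sum1_size mulnn.
rewrite !size_allpairs mulnn => /leq_trans; apply; rewrite leq_mul2l.
apply/orP; right; rewrite !big_allpairs big_seq [leqRHS]big_seq.
apply: leq_sum => a aA.
under eq_bigr do rewrite big_allpairs.
rewrite exchange_big /=; apply: leq_sum => a' _.
exact/sum_dilate_le/A_gt0.
Qed.

Definition ratios : seq F := undup [seq (a' / a)%R | a <- A, a' <- A].

Lemma sum_ratios (e : F -> nat) :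
  \sum_(a <- A) \sum_(a' <- A) e (a' / a)%R =
  \sum_(m <- ratios) richness A m * e m.
Proof.
transitivity
    (\sum_(m <- ratios) \sum_(a <- A) \sum_(a' <- A) (a' / a == m)%R * e m).
  rewrite [RHS]exchange_big /=; apply: eq_big_seq => a aA.
  rewrite [RHS]exchange_big /=; apply: eq_big_seq => a' a'A.
  transitivity (\sum_(m <- ratios) (a' / a == m)%R * e (a' / a)%R).
    rewrite -big_distrl /= sum_pred1 ?undup_uniq // mem_undup.
    by rewrite (allpairs_f (fun a a' => a' / a)%R) // mul1n.
  by apply: eq_bigr => m _; case: eqP => [->|].
apply: eq_bigr => m _; under eq_bigr do rewrite -big_distrl.
rewrite -big_distrl /= /richness -sum1_count [in RHS]big_mkcond /=.
congr (_ * _); apply: eq_big_seq => a aA.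
have a0 := A_gt0 aA; have -> : \sum_(a' <- A) (a' / a == m)%R =
  \sum_(a' <- A) (m * a == a')%R.
  apply: eq_bigr => a' _; congr (nat_of_bool _).
  by rewrite eq_sym -[LHS](inj_eq (mulIf (lt0r_neq0 a0))) divfK ?lt0r_neq0.
by rewrite sum_pred1 //; case: (_ \in _).
Qed.

(** Layer-cake summation: [richness A m] is the number of levels [t >= 1] not exceeding it. *)
Lemma sum_layers (D : seq F) (e : F -> nat) :
  \sum_(m <- D) richness A m * e m =
  \sum_(1 <= t < (size A).+1) \sum_(m <- [seq m <- D | t <= richness A m]) e m.
Proof.
under [RHS]eq_bigr do rewrite big_filter big_mkcond.
rewrite [RHS]exchange_big /=; apply: eq_bigr => m _.
rewrite -big_mkcond big_const_seq iter_addn_0 mulnC; congr (_ * _).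
rewrite -size_filter -[LHS](size_iota 1); apply/perm_size/uniq_perm.
- exact: iota_uniq.
- exact/filter_uniq/iota_uniq.
move=> t; rewrite mem_filter mem_index_iota mem_iota add1n !ltnS.
have := richness_le_size m; lia.
Qed.

Lemma size_sqr_le_harmonic :
  ((size A)%:R ^+ 2 <=
   18 * (size X)%:R * \sum_(1 <= t < (size A).+1) (t%:R^-1) :> F)%R.
Proof.
have [->|A0] := posnP (size A).
  by rewrite big_geq // mulr0 expr0n.
have S0 : 0 < size S by apply: leq_trans size_le_sums.
have := sqr_size_le_line_energies; rewrite sum_ratios sum_layers.
set n := size S; rewrite -(ler_nat F) natrM natr_sum => h.
have n4 : (0 < n%:R ^+ 4 :> F)%R by rewrite exprn_gt0 // ltr0n.
rewrite -(ler_pM2r n4).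
have -> : ((size A)%:R ^+ 2 * n%:R ^+ 4 = ((size A * n ^ 2) ^ 2)%:R :> F)%R.
  by rewrite !natrX natrM natrX; ring.
apply: (le_trans h).
have -> : (18 * (size X)%:R * (\sum_(1 <= t < (size A).+1) t%:R^-1) * n%:R ^+ 4 =
   (size X)%:R * \sum_(1 <= t < (size A).+1) (18 * n%:R ^+ 4 / t%:R) :> F)%R.
  by rewrite -mulr_sumr; ring.
rewrite ler_wpM2l // big_nat [leRHS]big_nat ler_sum // => t /andP[t0 tA].
rewrite ler_pdivlMr ?ltr0n // -!natrX -!natrM ler_nat mulnC.
apply: sum_rich_line_energy_le.
- exact/filter_uniq/undup_uniq.
- move=> m; rewrite mem_filter mem_undup => /andP[_ /allpairsP[[a a'] /=]].
  by move=> [aA a'A ->]; rewrite divr_gt0 ?A_gt0.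
- by rewrite t0 (leq_trans _ size_le_sums).
- by move=> m; rewrite mem_filter => /andP[].
Qed.

End Sums.

(** * Harmonic sums and logarithms over the reals *)

Local Open Scope ring_scope.
Local Notation R := Rdefinitions.R.

(* [log2] unfolds to the [ln] of Stdlib, not to that of MathComp-Analysis. *)
Lemma exp_ge1D (x : R) : 1 + x <= Rtrigo_def.exp x.
Proof. by apply/RleP; rewrite -[1]R1E -RplusE; apply: Rpower.exp_ineq1_le. Qed.

(** Converts the Stdlib literal [2] occurring in [log2]. *)
Lemma IZR2 : Rdefinitions.IZR (BinNums.Zpos (BinNums.xO BinNums.xH)) = 2 :> R.
Proof. by rewrite !RealsE. Qed.

(** This is [1 + u <= exp u] at [u = ln (n / (n + 1))]. *)
Lemma inv_le_sub_ln (n : nat) :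
  (0 < n)%N -> (n.+1%:R^-1 <= Rpower.ln n.+1%:R - Rpower.ln n%:R :> R).
Proof.
move=> n0.
have n0R : (0 < n%:R :> R) by rewrite ltr0n.
have n1R : (0 < n.+1%:R :> R) by rewrite ltr0n.
pose u : R := Rpower.ln n%:R - Rpower.ln n.+1%:R; have := exp_ge1D u.
have -> : Rtrigo_def.exp u = n%:R / n.+1%:R :> R.
  rewrite -[u]/(Rdefinitions.Rplus _ (Rdefinitions.Ropp _)).
  rewrite Exp_prop.exp_plus Rpower.exp_Ropp !Rpower.exp_ln; [|exact/RltP..].
  by rewrite !RealsE.
have -> : n%:R / n.+1%:R = 1 - n.+1%:R^-1 :> R.
  apply: (mulIf (lt0r_neq0 n1R)).
  by rewrite mulrBl divfK ?mulVf ?lt0r_neq0 // mul1r -natr1 addrK.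
by rewrite lerD2l lerNr opprB.
Qed.

Lemma harmonic_le_ln (n : nat) :
  (0 < n)%N -> \sum_(1 <= t < n.+1) t%:R^-1 <= 1 + Rpower.ln n%:R :> R.
Proof.
elim: n => // -[_ _|n IHn _].
  by rewrite big_nat1 invr1 -R1E Rpower.ln_1 R1E addr0.
rewrite big_nat_recr //=.
apply: (le_trans (lerD (IHn isT) (@inv_le_sub_ln n.+1 isT))).
by rewrite -addrA subrKC.
Qed.

Lemma ln2_gt0 : 0 < Rpower.ln 2%:R :> R.
Proof.
rewrite -IZR2; apply/RltP/(Raxioms.Rlt_trans _ _ _ _ Rpower.ln_lt_2).
exact/RIneq.Rinv_0_lt_compat/RIneq.Rlt_0_2.
Qed.

Lemma ln2_le1 : Rpower.ln 2%:R <= 1 :> R.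
Proof.
have := exp_ge1D (Rpower.ln 2%:R); rewrite Rpower.exp_ln; last first.
  by apply/RltP; rewrite ltr0n.
by rewrite -[leRHS]natr1 addrC lerD2r.
Qed.

Lemma ler_ln (x y : R) : 0 < x -> x <= y -> Rpower.ln x <= Rpower.ln y.
Proof.
move=> x0; rewrite le_eqVlt => /predU1P[->//|xy].
by apply/ltW/RltP/Rpower.ln_increasing; apply/RltP.
Qed.

(** The bound [n] is kept apart from [size B] so that the logarithm can be that of the original set,
    of which [B] is a part. *)
Lemma sqr_size_le_ln (B X : seq R) (n : nat) :
  uniq B -> {in B, forall b, 0 < b} -> uniq X ->
  (forall a b c d e, a \in B -> b \in B -> c \in B -> d \in B -> e \in B ->
    a * ((b + c) + (d + e)) \in X) ->
  (0 < size B <= n)%N ->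
  (size B)%:R ^+ 2 <= 18 * (size X)%:R * (1 + Rpower.ln n%:R) :> R.
Proof.
move=> uB B0 uX BX /andP[sB Bn].
pose S := undup [seq x + y | x <- B, y <- B].
have SP s : s \in S -> exists x y, [/\ x \in B, y \in B & s = x + y].
  by rewrite mem_undup => /allpairsP[[x y] [xB yB ->]]; exists x, y.
have BS : {in B &, forall a b, a + b \in S}.
  by move=> a b aB bB; rewrite mem_undup allpairs_f.
have S0 : {in S, forall s, 0 < s}.
  by move=> s /SP[x [y [xB yB ->]]]; rewrite addr_gt0 ?B0.
have SX a s s' : a \in B -> s \in S -> s' \in S -> a * (s + s') \in X.
  by move=> aB /SP[b [c [bB cB ->]]] /SP[d [e [dB eB ->]]]; apply: BX.
apply: (le_trans (size_sqr_le_harmonic uB (undup_uniq _) B0 BS S0 uX SX)).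
rewrite ler_wpM2l ?mulr_ge0 ?ler0n // (le_trans (harmonic_le_ln sB)) //.
by rewrite lerD2l ler_ln ?ltr0n // ler_nat.
Qed.

(** * Reduction to positive sets and the final constant *)

Lemma size_le_halves (A : seq R) : uniq A ->
  (size A <= size [seq a <- A | (0 < a)%R] + size [seq a <- A | (a < 0)%R] + 1)%N.
Proof.
move=> uA; rewrite !size_filter -(count_predC (fun a : R => 0 < a) A) -addnA.
rewrite leq_add2l.
have -> : count (predC (fun a : R => 0 < a)) A =
    count (predU (fun a : R => a < 0) (pred1 0)) A.
  by apply: eq_count => a /=; rewrite -leNgt le_eqVlt orbC.
rewrite -(leq_add2r (count (predI (fun a : R => a < 0) (pred1 0)) A)).
rewrite count_predUI (leq_trans _ (leq_addr _ _)) // leq_add2l.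
by rewrite count_uniq_mem // leq_b1.
Qed.

(** Take the larger of the two sign classes. The expression is homogeneous of degree 2, so negating
    all five variables does not change it and the same [X] serves for the negative class. *)
Lemma exists_positive_half (A X : seq R) : uniq A -> (2 <= size A)%N ->
  (forall a b c d e, a \in A -> b \in A -> c \in A -> d \in A -> e \in A ->
    a * ((b + c) + (d + e)) \in X) ->
  exists B : seq R, [/\ uniq B, {in B, forall b, 0 < b},
    (forall a b c d e, a \in B -> b \in B -> c \in B -> d \in B -> e \in B ->
      a * ((b + c) + (d + e)) \in X), (0 < size B <= size A)%N &
    (size A <= 3 * size B)%N].
Proof.
move=> uA A2 AX; have := size_le_halves uA.
set P := [seq a <- A | 0 < a]; set N := [seq a <- A | a < 0] => PN.
have PA : (size P <= size A)%N by rewrite size_filter count_size.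
have NA : (size N <= size A)%N by rewrite size_filter count_size.
(* From [2 <= n <= 2 * p + 1] follows [p >= 1], hence [n <= 3 * p]; the extra 1 stands for a
   possible zero in [A]. *)
have big_half (n p q : nat) : (2 <= n -> n <= p + q + 1 -> p <= n -> q <= p ->
    0 < p <= n /\ n <= 3 * p)%N by lia.
have [NP|/ltnW NP] := leqP (size N) (size P).
  have [P1 P2] := big_half _ _ _ A2 PN PA NP.
  exists P; split=> //; first exact: filter_uniq.
    by move=> b; rewrite mem_filter => /andP[].
  move=> a b c d e; rewrite !mem_filter.
  by move=> /andP[_ ?] /andP[_ ?] /andP[_ ?] /andP[_ ?] /andP[_ ?]; apply: AX.
rewrite [(size P + _)%N]addnC in PN; have [N1 N2] := big_half _ _ _ A2 PN NA NP.
exists [seq - a | a <- N]; rewrite !size_map; split=> //.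
- by rewrite map_inj_uniq ?filter_uniq //; apply: oppr_inj.
- by move=> _ /mapP[b + ->]; rewrite mem_filter oppr_gt0 => /andP[].
move=> ? ? ? ? ? /mapP[a aN ->] /mapP[b bN ->] /mapP[c cN ->].
move=> /mapP[d dN ->] /mapP[e eN ->].
move: aN bN cN dN eN; rewrite !mem_filter -!opprD mulrNN.
by move=> /andP[_ ?] /andP[_ ?] /andP[_ ?] /andP[_ ?] /andP[_ ?]; apply: AX.
Qed.

Lemma mem_prod_sum4 (A : {fset R}) (a b c d e : R) :
  a \in A -> b \in A -> c \in A -> d \in A -> e \in A ->
  a * ((b + c) + (d + e)) \in prod_sum4 A.
Proof.
move=> aA bA cA dA eA; rewrite addrA.
by do 4!(apply: in_imfset2 => //).
Qed.

Lemma sqr_size_le_prod_sum4 (A : {fset R}) : (2 <= size A)%N ->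
  (size A)%:R ^+ 2 <= 324 * (size (prod_sum4 A))%:R *
    (Rpower.ln (size A)%:R / Rpower.ln 2%:R : R) :> R.
Proof.
move=> A2; have [B [uB B0 BX BA AB]] :=
  exists_positive_half (fset_uniq A) A2 (@mem_prod_sum4 A).
have := sqr_size_le_ln uB B0 (fset_uniq _) BX BA.
move: (size A) (size (prod_sum4 A)) => n x in A2 AB BA * => hB.
pose l2 : R := Rpower.ln 2%:R; pose ln : R := Rpower.ln n%:R.
have ln0 : 0 <= ln.
  by rewrite (le_trans (ltW ln2_gt0)) // ler_ln ?ltr0n ?ler_nat.
have lnD : ln <= ln / l2 by rewrite ler_pdivlMr ?ln2_gt0 // ler_piMr // ln2_le1.
have l1 : 1 <= ln / l2.
  by rewrite ler_pdivlMr ?ln2_gt0 // mul1r ler_ln ?ltr0n ?ler_nat.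
have AB2 : n%:R ^+ 2 <= 9 * (size B)%:R ^+ 2 :> R.
  by rewrite -!natrX -natrM ler_nat; rewrite -leq_sqr expnMn in AB.
apply: (le_trans AB2).
(* The 9 comes from squaring [size A <= 3 * size B]; the doubling absorbs [1 + ln], since each term
   is at most [ln / l2] by [l1] and [lnD]. *)
have -> : 324 * x%:R * (ln / l2) = 9 * (18 * x%:R * (ln / l2 *+ 2)).
  by rewrite mulr2n; ring.
rewrite ler_wpM2l // (le_trans hB) // ler_wpM2l ?mulr_ge0 ?ler0n //.
by rewrite mulr2n lerD.
Qed.

(* [Reals] comes late: it rebinds the keys [%R] and [%N], the power on [nat] and
   the tactics [ring] and [lra]. *)
From Stdlib Require Import Reals.
Local Open Scope fset_scope.

Theorem theorem2p7 :
  exists c : R, 0 < c /\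
    forall A : {fset R}, (2 <= #|` A|)%nat ->
      c * ((#|` A|%:R : R) ^+ 2 / log2 (#|` A|%:R)) <= (#|` prod_sum4 A|%:R : R).
Proof.
exists 324^-1; split; first by rewrite invr_gt0 ltr0n.
move=> A A2; have h := sqr_size_le_prod_sum4 A2.
have -> : log2 #|` A|%:R = ln #|` A|%:R / ln 2%:R :> R.
  by rewrite /log2 RdivE IZR2.
have l0 : 0 < ln #|` A|%:R / ln 2%:R :> R.
  rewrite divr_gt0 ?ln2_gt0 // (lt_le_trans ln2_gt0) //.
  by rewrite ler_ln ?ltr0n ?ler_nat.
by rewrite mulrC ler_pdivrMr ?ltr0n // ler_pdivrMr // [_ * 324]mulrC.
Qed.
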